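(* For a positive integer $t$, let $L(t)$ be the largest number of edges in a $t$-vertex layered graph. Then, as $t\to\infty$, $$\frac14 t\log t+\frac18 t\log\log t-O(t)\ \leq\ L(t)\ \leq\ \frac14 t\log t+(1+o(1))\,t\log\log t,$$ where $\log$ denotes the logarithm to base $2$.
   Context: All logarithms are base $2$. For a natural number $n$, the hypercube $Q_n$ on the ground set $[n]=\{1,\ldots,n\}$ is the graph whose vertices are the subsets of $[n]$, two vertices being adjacent if and only if their symmetric difference has size $1$. An edge-layer of $Q_n$ is the subgraph of $Q_n$ induced by $\binom{[n]}{k}\cup\binom{[n]}{k-1}$ for some $k\in[n]$, where $\binom{[n]}{j}$ denotes the family of all $j$-element subsets of $[n]$. A graph is called layered if it is isomorphic to a (not necessarily induced) subgraph of some edge-layer of $Q_n$, for some $n$. In $L(t)$ the maximum is over all layered graphs with exactly $t$ vertices, with $n$ and $k$ arbitrary; equivalently, $L(t)$ is the largest number of edges induced by $t$ vertices from two consecutive vertex layers of a hypercube of arbitrary dimension. The notation $O(\cdot)$ and $o(1)$ is with respect to $t\to\infty$, with absolute implied constants. *)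

(* Defs.v *)
From HB Require Import structures.
From mathcomp Require Import all_boot all_order all_algebra.
From mathcomp Require Import all_classical all_reals all_analysis.

Set Implicit Arguments.
Unset Strict Implicit.
Unset Printing Implicit Defensive.

Import Order.TTheory GRing.Theory Num.Theory.

Local Open Scope set_scope.

(* A simple graph is a pair (V, E) with V a finite set of elements of an ambient
   finite type T and E a set of 2-element subsets of V; keeping V apart from T
   lets subgraphs and their hosts live in the same type. *)
Definition is_simple_graph (T : finType) (G : {set T} * {set {set T}}) : bool :=
  [forall e in G.2, (#|e| == 2) && (e \subset G.1)].

Record sgraph (T : finType) := SGraph {
  sgraph_val : {set T} * {set {set T}};
  sgraphP : is_simple_graph sgraph_val }.

HB.instance Definition _ (T : finType) := [isSub for @sgraph_val T].
HB.instance Definition _ (T : finType) := [Finite of sgraph T by <:].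

Definition vertices (T : finType) (G : sgraph T) : {set T} := (sgraph_val G).1.
Definition edges (T : finType) (G : sgraph T) : {set {set T}} :=
  (sgraph_val G).2.

Definition subgraph (T : finType) (H G : sgraph T) : bool :=
  (vertices H \subset vertices G) && (edges H \subset edges G).

Definition isomorphic (T U : finType) (G : sgraph T) (H : sgraph U) : Prop :=
  exists f : T -> U,
    [/\ {in vertices G &, injective f},
        f @: vertices G = vertices H
      & [set f @: (e : {set T}) | e in edges G] = edges H].

Lemma induced_subproof (T : finType) (G : sgraph T) (S : {set T}) :
  is_simple_graph
    (vertices G :&: S, [set e in edges G | e \subset S]).
Proof.
apply/forall_inP => e; rewrite inE => /andP[eE eS].
have /forall_inP/(_ _ eE)/andP[-> eV] := sgraphP G.
by rewrite finset.subsetI eV.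
Qed.

Definition induced (T : finType) (G : sgraph T) (S : {set T}) : sgraph T :=
  SGraph (induced_subproof G S).

Definition symdiff (T : finType) (A B : {set T}) : {set T} :=
  (A :\: B) :|: (B :\: A).

Lemma hypercube_subproof (n : nat) :
  is_simple_graph
    ([set: {set 'I_n}],
     [set e : {set {set 'I_n}} |
        [exists A, exists B, (e == [set A; B]) && (#|symdiff A B| == 1)]]).
Proof.
apply/forall_inP => e; rewrite inE => /existsP[A /existsP[B /andP[/eqP-> AB]]].
rewrite finset.subsetT andbT cards2.
case: (eqVneq A B) AB => // ->.
by rewrite /symdiff finset.setDv finset.setU0 cards0.
Qed.

(* The ground set [n] is encoded as 'I_n = {0, ..., n - 1}. *)
Definition hypercube (n : nat) : sgraph {set 'I_n} :=
  SGraph (hypercube_subproof n).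

Definition vertex_layer (n k : nat) : {set {set 'I_n}} :=
  [set A : {set 'I_n} | #|A| == k].

(* Meaningful for 1 <= k <= n, which [layered] requires. *)
Definition edge_layer (n k : nat) : sgraph {set 'I_n} :=
  induced (hypercube n) (vertex_layer n k :|: vertex_layer n k.-1).

Definition layered (T : finType) (G : sgraph T) : Prop :=
  exists (n k : nat) (H : sgraph {set 'I_n}),
    [/\ (1 <= k <= n)%N, subgraph H (edge_layer n k) & isomorphic G H].

(* Up to isomorphism a t-vertex graph has vertex set 'I_t, so the maximum over
   all finite types is the one below; see [leq_L] and [L_attained]. *)
Definition L (t : nat) : nat :=
  \max_(G : sgraph 'I_t | (#|vertices G| == t) && `[< layered G >]) #|edges G|.

Lemma vertices_edge (T : finType) (G : sgraph T) (e : {set T}) (x : T) :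
  e \in edges G -> x \in e -> x \in vertices G.
Proof.
move=> eE xe; have /forall_inP/(_ _ eE)/andP[_ /fintype.subsetP] := sgraphP G.
exact.
Qed.

Lemma leq_L (T : finType) (G : sgraph T) (t : nat) :
  #|vertices G| = t -> layered G -> (#|edges G| <= L t)%N.
Proof.
move=> Gt [n [k [H [kn HE [f [finj fV fE]]]]]]; subst t.
set t := #|vertices G|.
pose g : 'I_t -> T := @enum_val T (mem (vertices G)).
have gV i : g i \in vertices G by apply: enum_valP.
have ginj : injective g by apply: enum_val_inj.
have gK e : e \in edges G -> g @: (g @^-1: e) = e.
  move=> eE; apply/finset.setP => x; apply/imsetP/idP => [[i + ->]|xe].
    by rewrite inE.
  have xV := vertices_edge eE xe.
  by exists (enum_rank_in xV x); rewrite ?inE /g enum_rankK_in.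
pose E := [set g @^-1: (e : {set T}) | e in edges G].
have EP : is_simple_graph ([set: 'I_t], E).
  apply/forall_inP => _ /imsetP[e eE ->]; rewrite finset.subsetT andbT.
  have /forall_inP/(_ _ eE)/andP[/eqP <- _] := sgraphP G.
  by rewrite -[in X in _ == X](gK e eE) card_imset.
have cE : #|E| = #|edges G|.
  apply: card_in_imset => e1 e2 e1E e2E e12.
  by rewrite -(gK e1 e1E) e12 gK.
rewrite -cE -[E]/(edges (SGraph EP)).
apply: (bigop.bigmax_sup (SGraph EP)) => //.
rewrite [vertices _]/= cardsT card_ord eqxx /=.
apply/asboolP; exists n, k, H; split=> //; exists (f \o g); split.
- by move=> i j _ _ /= /finj fij; apply/ginj/fij.
- suff VE : g @: [set: 'I_t] = vertices G.
    by rewrite -fV -VE -finset.imset_comp.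
  apply/finset.setP => x; apply/imsetP/idP => [[i _ ->]|xV]; first exact: gV.
  by exists (enum_rank_in xV x); rewrite ?inE // /g enum_rankK_in.
- rewrite -fE /edges /= /E -finset.imset_comp; apply: eq_in_imset => e eE /=.
  by rewrite finset.imset_comp gK.
Qed.

Lemma edgeless_subproof (T : finType) (V : {set T}) :
  is_simple_graph (V, finset.set0).
Proof. by apply/forall_inP => e; rewrite inE. Qed.

Lemma L_attained (t : nat) : (0 < t)%N ->
  exists G : sgraph 'I_t,
    [/\ #|vertices G| = t, layered G & #|edges G| = L t].
Proof.
move=> t0; pose G0 := SGraph (edgeless_subproof [set: 'I_t]).
have G0P : (#|vertices G0| == t) && `[< layered G0 >].
  rewrite [vertices _]/= cardsT card_ord eqxx /=; apply/asboolP.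
  pose S := [set [set i] | i : 'I_t].
  exists t, 1%N, (SGraph (edgeless_subproof S)); split.
  - by rewrite t0.
  - rewrite /subgraph finset.sub0set andbT; apply/fintype.subsetP => _ /imsetP[i _ ->].
    by rewrite !inE cards1.
  - exists (@finset.set1 _); split=> //; first by move=> i j _ _; apply: finset.set1_inj.
      by apply/finset.setP => A; apply/imsetP/imsetP => -[i _ ->]; exists i; rewrite ?inE.
    by rewrite /edges /= finset.imset0.
rewrite /L; have [|G /andP[/eqP GV /asboolP GL] ->] :=
  @eq_bigmax_cond _ [pred G : sgraph 'I_t | (#|vertices G| == t) && `[< layered G >]]
    (fun G => #|edges G|).
  by apply/card_gt0P; exists G0.
by exists G.
Qed.

Local Open Scope ring_scope.

Definition log2 (R : realType) (x : R) : R := ln x / ln 2.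

(* Main.v *)
Require Import Defs.
From mathcomp Require Import all_boot all_order all_algebra.
From mathcomp Require Import all_classical all_reals all_analysis.
From mathcomp Require Import ring lra zify.

Import Order.TTheory GRing.Theory Num.Theory.
Import numFieldNormedType.Exports.

Local Open Scope classical_set_scope.
Local Open Scope ring_scope.

(* Lower bound.  The two middle layers of Q_(2k-1) have 'C(2k, k) vertices and
   are k-regular.  Disjoint unions of layered graphs are layered, so a greedy
   expansion of t in central binomials gives 2 L(t) >= (k - 2) t whenever
   'C(2k, k) <= t, and k is about (log t) / 2 + (log log t) / 4.

   Upper bound.  Let u and w count the vertices in the upper and lower layer,
   t = u + w and y = (w - u) / (2t).  Splitting along a coordinate i cuts at most
   min(w0, u1) edges, where w0 counts the lower sets avoiding i and u1 the upper
   sets containing i.  By induction the number of edges is at most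
     t (log t / 4 - y^2 (log t + A) / 21 + (4/3) ln (log t + A) + B).
   With q = t0 / t and d = y0 - y1, a split saves a quarter of the binary entropy
   h(q) >= 4 q (1 - q); the gain min(w0, u1) / t <= q (1 - q) (1 + d) exceeds this
   by at most q (1 - q) d, which is paid for by the convexity of the penalty
   (worth q (1 - q) d^2 log t) and the log log term (worth h(q) / log t).  The
   penalty itself grows by O(y^2 h(q)) because its weight depends on log t; this
   is covered by the second-order slack in the entropy inequality when q is far
   from 1/2, and by the slack in the bound on the minimum when q - 1/2 is far
   from -y.  Since 4/3 < 1 / ln 2, the log log coefficient is below 1. *)

(** * Pairs of consecutive sets *)

Section CoverPairs.
Local Open Scope nat_scope.
Local Open Scope set_scope.

(** A pair (i, A) stands for the edge from A in the lower family [W] to A + i in the upper family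
    [U]. Set sizes are left free, so both halves of a split are again instances. *)
Definition cover_pairs {T : finType} (U W : {set {set T}}) : {set T * {set T}} :=
  [set p | [&& p.2 \in W, p.1 \notin p.2 & p.1 |: p.2 \in U]].

Definition having {T : finType} (i : T) (U : {set {set T}}) : {set {set T}} :=
  [set A in U | i \in A].

Definition lacking {T : finType} (i : T) (U : {set {set T}}) : {set {set T}} :=
  [set A in U | i \notin A].

(** An edge in a direction other than i stays on one side of the split. An edge in direction i is
    determined by its lower end, which lacks i, and also by its upper end, which has i. *)
Lemma cover_pairs_split {T : finType} (U W : {set {set T}}) (i : T) :
  #|cover_pairs U W| <=
  #|cover_pairs (lacking i U) (lacking i W)| +
  #|cover_pairs (having i U) (having i W)| + minn #|lacking i W| #|having i U|.
Proof.
pose D := [set p in cover_pairs U W | p.1 == i].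
have DW : #|D| <= #|lacking i W|.
  rewrite -(@card_in_imset _ _ snd (mem D)); last first.
    move=> [j A] [l B]; rewrite !inE /= => /andP[_ /eqP->] /andP[_ /eqP->].
    by move=> ->.
  apply/subset_leq_card/fintype.subsetP => _ /imsetP[[j A] + ->].
  by rewrite !inE /= => /andP[/and3P[-> + _] /eqP <-].
have DU : #|D| <= #|having i U|.
  rewrite -(@card_in_imset _ _ (fun p => p.1 |: p.2) (mem D)); last first.
    move=> [j A] [l B]; rewrite !inE /= => /andP[/and3P[_ jA _] /eqP ?].
    move=> /andP[/and3P[_ iB _] /eqP ?]; subst j l => AB; congr (_, _).
    by rewrite -(setU1K jA) AB setU1K.
  apply/subset_leq_card/fintype.subsetP => _ /imsetP[[j A] + ->].
  by rewrite !inE /= => /andP[/and3P[_ _ ->] /eqP <-]; rewrite eqxx.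
suff sub : cover_pairs U W \subset (cover_pairs (lacking i U) (lacking i W)
      :|: cover_pairs (having i U) (having i W)) :|: D.
  apply: leq_trans (subset_leq_card sub) _.
  apply: leq_trans (leq_card_setU _ _) _; apply: leq_add.
    exact: leq_card_setU.
  by rewrite leq_min DW DU.
apply/fintype.subsetP => -[j A]; rewrite !inE /= => /and3P[-> jA ->].
rewrite jA /= eq_sym; case: eqVneq => [<-|ij] //=; first by rewrite orbT.
by case: (i \in A).
Qed.

(** The ends of an edge in direction i differ at i, so no edge exists when every coordinate is
    constant on the family. *)
Lemma cover_pairs_eq0 {T : finType} (U W : {set {set T}}) :
  (forall i, having i (U :|: W) = finset.set0 \/
             lacking i (U :|: W) = finset.set0) ->
  cover_pairs U W = finset.set0.
Proof.
move=> H; apply/finset.setP => -[i A]; rewrite !inE /=; apply/negP.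
move=> /and3P[AW iA AU]; case: (H i) => /finset.setP.
- by move/(_ (i |: A)); rewrite !inE AU eqxx.
- by move/(_ A); rewrite !inE AW orbT iA.
Qed.

Lemma layered_cover_pairs {T : finType} (G : sgraph T) : layered G ->
  exists (n : nat) (U W : {set {set 'I_n}}),
    #|U| + #|W| = #|vertices G| /\ #|edges G| <= #|cover_pairs U W|.
Proof.
move=> [n [k [H [kn /andP[HV HE] [f [finj fV fE]]]]]].
exists n, (vertices H :&: vertex_layer n k), (vertices H :&: vertex_layer n k.-1).
set U := _ :&: _; set W := _ :&: _; split.
  rewrite -(card_in_imset finj) fV -cardsUI -finset.setIUr.
  have -> : U :&: W = finset.set0.
    apply/finset.setP => A; rewrite !inE; apply/negP.
    move=> /andP[/andP[_ /eqP->] /andP[_ /eqP]]; lia.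
  rewrite cards0 addn0; congr #|pred_of_set _|; apply/finset.setIidPl.
  by apply: fintype.subset_trans HV _; rewrite /vertices /= finset.subsetIr.
(* [f] is injective on vertices only; edges have distinct images because they consist of
   vertices. *)
have eGH : #|edges G| = #|edges H|.
  rewrite -fE card_in_imset // => e1 e2 e1G e2G e12.
  have sub (e : {set T}) : e \in edges G -> {subset e <= vertices G}.
    by move=> eG x; apply: vertices_edge.
  have half (a b : {set T}) : a \in edges G -> b \in edges G ->
      f @: a = f @: b -> a \subset b.
    move=> aG bG ab; apply/fintype.subsetP => x xa.
    have : f x \in f @: b by rewrite -ab imset_f.
    move=> /imsetP[y yb /finj -> //]; first exact: (sub a).
    exact: (sub b).
  by apply/eqP; rewrite finset.eqEsubset !half.
rewrite eGH.
pose g (p : 'I_n * {set 'I_n}) := [set p.2; p.1 |: p.2].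
suff : edges H \subset g @: cover_pairs U W.
  by move=> /subset_leq_card /leq_trans; apply; apply: leq_imset_card.
apply/fintype.subsetP => e eH; have := fintype.subsetP HE _ eH.
rewrite /edges /= !inE => /andP[/existsP[A /existsP[B /andP[/eqP eAB AB]]] eS].
have AH : A \in vertices H by apply: vertices_edge eH _; rewrite eAB !inE eqxx.
have BH : B \in vertices H by apply: vertices_edge eH _; rewrite eAB !inE eqxx orbT.
have {eS}[AS BS] : (#|A| == k) || (#|A| == k.-1) /\ (#|B| == k) || (#|B| == k.-1).
  have := fintype.subsetP eS; rewrite eAB => sub.
  by move: (sub A) (sub B); rewrite !inE !eqxx !orbT => /(_ isT)-> /(_ isT)->.
have main (X Y : {set 'I_n}) : X \in vertices H -> Y \in vertices H ->
   (#|X| == k) || (#|X| == k.-1) -> (#|Y| == k) || (#|Y| == k.-1) ->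
   Y :\: X = finset.set0 -> #|X :\: Y| = 1 -> [set X; Y] \in g @: cover_pairs U W.
  move=> XH YH Xk Yk YX /eqP/cards1P[i XY].
  have sYX : Y \subset X by rewrite -finset.setD_eq0 YX.
  have iY : i \notin Y.
    by have /finset.setP/(_ i) := XY; rewrite !inE eqxx => /andP[].
  have XE : X = i |: Y.
    by rewrite -[LHS](finset.setID X Y) XY (finset.setIidPr sYX) finset.setUC.
  apply/imsetP; exists (i, Y); last by rewrite /g /= -XE finset.setUC.
  rewrite !inE /= iY -XE XH YH /=.
  move: Xk Yk; rewrite XE cardsU1 iY /=; lia.
(* One of the two differences is empty, so the ends of the edge are nested. *)
have : #|A :\: B| + #|B :\: A| = 1.
  move/eqP: AB; rewrite /symdiff cardsU.
  suff -> : (A :\: B) :&: (B :\: A) = finset.set0 by rewrite cards0 subn0.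
  by apply/finset.setP => x; rewrite !inE; case: (x \in A); rewrite ?andbF.
case cAB : #|A :\: B| => [|[|//]].
  rewrite add0n => cBA; rewrite eAB finset.setUC.
  by apply: main => //; apply/eqP; rewrite -cards_eq0 cAB.
move=> /eqP; rewrite -[X in _ == X]addn0 eqn_add2l cards_eq0 => /eqP BA.
by rewrite eAB; apply: main.
Qed.

End CoverPairs.

(** * An entropy inequality *)

(** exp (3/4) >= (1 + 3/20)^5 > 2. This is the source of 4/3 < 1 / ln 2. *)
Lemma ln2_lt34 {R : realType} : ln 2 < 3 / 4 :> R.
Proof.
rewrite -ltr_expR lnK ?posrE//.
have -> : (3 / 4 : R) = 5%:R * (3 / 20) by lra.
rewrite expRM_natl.
have h : (23 / 20 : R) <= expR (3 / 20) by apply: le_trans (expR_ge1Dx _); lra.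
apply: lt_le_trans (lerXn2r 5 _ _ h); rewrite ?nnegrE ?expR_ge0//; lra.
Qed.

Lemma ln2_ge12 {R : realType} : 1 / 2 <= ln 2 :> R.
Proof.
have : ln (1 + - (1/2)) <= - (1/2) :> R by apply: le_ln1Dx; lra.
rewrite (_ : 1 + - (1/2) = 2^-1 :> R); last by lra.
rewrite lnV ?posrE//; lra.
Qed.

Section BinaryEntropy.
Context {R : realType}.
Implicit Types q x a b : R.

Definition natural_entropy q := - q * ln q - (1 - q) * ln (1 - q).

(** The slack in the entropy inequality, followed by its first and second derivatives. *)
Let F q := natural_entropy q - 4 * (q * (1 - q)) * (ln 2 + (1 - 2 * q) ^+ 2 / 12).
Let F1 q := ln (1 - q) - ln q - 2 * (2 * ln 2 - 1 / 6) * (1 - 2 * q)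
            - 2 / 3 * (1 - 2 * q) ^+ 3.
Let F2 q := 4 * (2 * ln 2 - 1 / 6) + 4 * (1 - 2 * q) ^+ 2 - q^-1 - (1 - q)^-1.

Let d_atoms q : 0 < q < 1 ->
  [/\ is_derive q 1 (@ln R) q^-1,
      is_derive q 1 (cst 1 - id : R -> R) (- 1),
      is_derive q 1 (@ln R \o (cst 1 - id) : R -> R) ((1 - q)^-1 * -1)
    & is_derive q 1 (cst 1 - 2 \*: id : R -> R) (- 2)].
Proof.
move=> /andP[q0 q1]; have q1' : 0 < 1 - q by lra.
have d1 : is_derive q 1 (@ln R) q^-1 by apply: is_derive1_ln.
have d2 : is_derive q 1 (cst 1 - id : R -> R) (- 1).
  by apply: is_derive_eq; rewrite sub0r.
split=> //.
- by apply: is_derive1_comp; apply: is_derive1_ln.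
- by apply: is_derive_eq; rewrite sub0r /GRing.scale /= mulr1.
Qed.

Let dF q : 0 < q < 1 -> is_derive q 1 F (F1 q).
Proof.
move=> q01; have [d1 d2 d3 d4] := d_atoms q q01; have [q0] := andP q01.
rewrite -subr_gt0 => q1.
rewrite (_ : F = - (id * @ln R) - (cst 1 - id) * (@ln R \o (cst 1 - id))
    - 4 \*: (id * (cst 1 - id) * (cst (ln 2) + 12^-1 \*: (cst 1 - 2 \*: id) ^+ 2)));
  last first.
  apply/funext => x.
  rewrite /F /natural_entropy !fctE /= /GRing.scale /=; ring.
apply: is_derive_eq.
rewrite /F1 !fctE /= -![_ *: _]/(_ * _).
by field; rewrite !gt_eqF.
Qed.

Let dF1 q : 0 < q < 1 -> is_derive q 1 F1 (F2 q).
Proof.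
move=> q01; have [d1 d2 d3 d4] := d_atoms q q01; have [q0] := andP q01.
rewrite -subr_gt0 => q1.
rewrite (_ : F1 = @ln R \o (cst 1 - id) - @ln R
    - (2 * (2 * ln 2 - 1 / 6)) \*: (cst 1 - 2 \*: id)
    - (2 / 3) \*: (cst 1 - 2 \*: id) ^+ 3); last first.
  apply/funext => x.
  rewrite /F1 !fctE /= /GRing.scale /=; ring.
apply: is_derive_eq.
rewrite /F2 !fctE /= -![_ *: _]/(_ * _).
by field; rewrite !gt_eqF.
Qed.

Let mvt (f df : R -> R) a b : 0 < a -> a < b -> b < 1 ->
  (forall q, 0 < q < 1 -> is_derive q 1 f (df q)) ->
  exists2 c, a < c < b & f b - f a = df c * (b - a).
Proof.
move=> a0 ab b1 fdf.
have [||c cab ->] := @MVT R f df a b ab.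
- by move=> x; rewrite in_itv /= => /andP[? ?]; apply: fdf; lra.
- apply: derivable_within_continuous => x; rewrite in_itv /= => /andP[? ?].
  have := fdf x; case; first lra. by [].
- by exists c => //; move: cab; rewrite in_itv.
Qed.

(** In terms of A = q (1 - q), [F2] is a constant minus 16 A + 1/A, and the latter decreases for A
    <= 1/4. *)
Let F2_le a b : 0 < a -> a <= b -> b <= 1 / 2 -> F2 a <= F2 b.
Proof.
move=> a0 ab b2; rewrite /F2.
have E x : 0 < x -> x < 1 -> x^-1 + (1 - x)^-1 = (x * (1 - x))^-1.
  by move=> x0 x1; field; rewrite !gt_eqF//; lra.
suff : 4 * (1 - 2 * a) ^+ 2 - 4 * (1 - 2 * b) ^+ 2 <= 
   (a * (1 - a))^-1 - (b * (1 - b))^-1.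
  by rewrite -!E; lra.
set A := a * (1 - a); set B := b * (1 - b).
have A0 : 0 < A by rewrite mulr_gt0//; lra.
have AB : A <= B by rewrite /A /B; nra.
have B4 : B <= 1 / 4 by rewrite /B; nra.
have -> : 4 * (1 - 2 * a) ^+ 2 - 4 * (1 - 2 * b) ^+ 2 = 16 * (B - A).
  by rewrite /A /B; ring.
have B0 : 0 < B by lra.
clearbody A B.
rewrite (_ : A^-1 - B^-1 = (B - A) / (A * B)); last first.
  by field; rewrite !gt_eqF.
rewrite ler_pdivlMr ?mulr_gt0//.
have : A * B <= 1 / 16 by nra.
nra.
Qed.

Let F_half : F (1 / 2) = 0.
Proof.
rewrite /F /natural_entropy (_ : 1 - 1 / 2 = 1 / 2 :> R); last by lra.
rewrite !div1r lnV ?posrE//.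
by field.
Qed.

Let F1_half : F1 (1 / 2) = 0.
Proof.
rewrite /F1 (_ : 1 - 1 / 2 = 1 / 2 :> R); last by lra.
by rewrite (_ : 1 - 2 * (1 / 2) = 0 :> R); [ring|lra].
Qed.

Let ln_le_subr1 x : 0 < x -> ln x <= x - 1.
Proof. by move=> x0; have := @le_ln1Dx R (x - 1); rewrite subrKC; apply; lra. Qed.

(** Here - q ln q >= 4 q, while the subtracted term is at most 4 q (3/4 + 1/12). This gives a left
    endpoint for the mean value argument without a limit at 0. *)
Let F_ge0_small q : 0 < q -> q <= expR (- 4) -> 0 <= F q.
Proof.
move=> q0 qe.
have lnq : ln q <= - 4 by rewrite -[leRHS]expRK ler_ln ?posrE ?expR_gt0.
have q1 : q < 1 by apply: le_lt_trans qe _; rewrite expR_lt1; lra.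
have l1 := ln_le_subr1 (1 - q).
have ln1q : ln (1 - q) <= 0 by apply: ln_le0; lra.
have l2 := @ln2_lt34 R.
rewrite /F /natural_entropy.
have := sqr_ge0 (1 - 2 * q) => s0.
have s1 : (1 - 2 * q) ^+ 2 <= 1 by nra.
have : 4 * (q * (1 - q)) * (ln 2 + (1 - 2 * q) ^+ 2 / 12) <= 4 * q * (5 / 6).
  have l3 := @ln2_ge12 R.
  set M := ln 2 + _; have M0 : 0 <= M by rewrite /M; lra.
  have M1 : M <= 5 / 6 by rewrite /M; lra.
  have : (1 - q) * M <= 5 / 6 by nra.
  have -> : 4 * (q * (1 - q)) * M = 4 * q * ((1 - q) * M) by ring.
  by move=> ?; rewrite ler_pM2l//; lra.
have : 4 * q <= - q * ln q by nra.
have : 0 <= - (1 - q) * ln (1 - q) by nra.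
nra.
Qed.

(* [F2] is nondecreasing on ]0, 1/2], so a negative value of [F] between a point
   where it is nonnegative and the double zero 1/2 contradicts the mean value
   theorem. *)
Let F_ge0_half q : 0 < q -> q < 1 / 2 -> 0 <= F q.
Proof.
move=> q0 q2; case: (leP q (expR (- 4))) => [|qe]; first exact: F_ge0_small.
rewrite leNgt; apply/negP => Fq.
have e0 := expR_gt0 (- 4 : R).
have Fe := F_ge0_small _ e0 (lexx _).
have [|c1 /andP[? ?] E1] := @mvt F F1 _ _ e0 qe _ dF; first lra.
have [|c2 /andP[? ?] E2] := @mvt F F1 _ _ q0 q2 _ dF; first lra.
rewrite F_half in E2.
have F1c1 : F1 c1 < 0 by nra.
have F1c2 : 0 < F1 c2 by nra.
have [|||c3 /andP[? ?] E3] := @mvt F1 F2 c1 c2 _ _ _ dF1; [lra..|].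
have [|||c4 /andP[? ?] E4] := @mvt F1 F2 c2 (1 / 2) _ _ _ dF1; [lra..|].
rewrite F1_half in E4.
have : F2 c3 <= F2 c4 by apply: F2_le; lra.
have : 0 < F2 c3 by nra.
have : F2 c4 < 0 by nra.
lra.
Qed.

Lemma natural_entropy_ge q : 0 < q < 1 ->
  4 * (q * (1 - q)) * (ln 2 + (1 - 2 * q) ^+ 2 / 12) <= natural_entropy q.
Proof.
move=> /andP[q0 q1]; rewrite -subr_ge0 -/(F q).
have [q2|q2|->] := ltgtP q (1 / 2); [exact: F_ge0_half| |by rewrite F_half].
suff -> : F q = F (1 - q) by apply: F_ge0_half; lra.
rewrite /F /natural_entropy (_ : 1 - (1 - q) = q); last by ring.
ring.
Qed.

End BinaryEntropy.

(** * The potential *)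

(** With z = q - 1/2 + y, y the mean imbalance, the two bounds on g are q (1 - q) (1 + y0 - y1) plus
    q z and minus (1 - q) z. As |z| <= 1, the smaller one lies q (1 - q) z^2 below the common
    term. *)
Lemma split_gain {R : realFieldType} (q y0 y1 g : R) : 0 < q < 1 ->
  `|y0| <= 1 / 2 -> `|y1| <= 1 / 2 ->
  g <= q * (1 / 2 + y0) -> g <= (1 - q) * (1 / 2 - y1) ->
  g <= q * (1 - q) * (1 + (y0 - y1) -
         (q - 1 / 2 + (q * y0 + (1 - q) * y1)) ^+ 2).
Proof.
rewrite !ler_norml => /andP[q0 q1] /andP[? ?] /andP[? ?].
have -> : q * (1 / 2 + y0) = q * (1 - q) * (1 + (y0 - y1)) +
   q * (q - 1 / 2 + (q * y0 + (1 - q) * y1)) by field.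
have -> : (1 - q) * (1 / 2 - y1) = q * (1 - q) * (1 + (y0 - y1)) -
   (1 - q) * (q - 1 / 2 + (q * y0 + (1 - q) * y1)) by field.
set z := q - _ + _ => g1 g2.
have z1 : z <= 1 by rewrite /z; nra.
have z0 : - 1 <= z by rewrite /z; nra.
clearbody z; case: (leP 0 z) => zs.
- suff : q * (1 - q) * z ^+ 2 <= (1 - q) * z by lra.
  have -> : q * (1 - q) * z ^+ 2 = (1 - q) * z * (q * z) by ring.
  rewrite -[leRHS]mulr1 ler_wpM2l//; first by rewrite mulr_ge0//; lra.
  nra.
- suff : q * (1 - q) * z ^+ 2 <= - q * z by lra.
  have -> : q * (1 - q) * z ^+ 2 = - q * z * (- (1 - q) * z) by ring.
  rewrite -[leRHS]mulr1 ler_wpM2l//; first by rewrite mulr_le0//; lra.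
  nra.
Qed.

(** The inductive step divided by t: a and b stand for - log q and - log (1 - q), h for the binary
    entropy, [Lam] for the shifted logarithm of t. *)
Lemma normalized_split {R : realFieldType} (q y0 y1 a b Lam g : R) :
  let h := q * a + (1 - q) * b in
  0 < q < 1 -> `|y0| <= 1 / 2 -> `|y1| <= 1 / 2 -> 0 <= a -> 0 <= b ->
  64 * 180 <= Lam ->
  4 * (q * (1 - q)) * (1 + 4 / 9 * (q - 1 / 2) ^+ 2) <= h ->
  g <= q * (1 / 2 + y0) -> g <= (1 - q) * (1 / 2 - y1) ->
  g <= h / 4 + 1 / 21 * Lam * (q * (1 - q)) * (y0 - y1) ^+ 2
       - 1 / 21 * (q * a * y0 ^+ 2 + (1 - q) * b * y1 ^+ 2)
       + 4 / 3 * (h / Lam).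
Proof.
move=> h q01 hy0 hy1 a0 b0 L0 hh g1 g2.
have {g1 g2} gz := @split_gain R q y0 y1 g q01 hy0 hy1 g1 g2.
move: hy0 hy1 q01; rewrite !ler_norml => /andP[y0l y0u] /andP[y1l y1u] /andP[q0 q1].
set Q := q * (1 - q) in hh gz *.
have Q0 : 0 < Q by rewrite mulr_gt0//; lra.
set d := y0 - y1 in gz *.
have h0 : 0 <= h by rewrite addr_ge0// mulr_ge0//; lra.
have Lp : 0 < Lam by lra.
have hL : 0 <= h / Lam by rewrite divr_ge0// ltW.
have qa0 : 0 <= q * a by rewrite mulr_ge0// ltW.
have qb0 : 0 <= (1 - q) * b by rewrite mulr_ge0//; lra.
have y0s : y0 ^+ 2 <= 1 / 4 by nra.
have y1s : y1 ^+ 2 <= 1 / 4 by nra.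
have d1 : d <= 1 by rewrite /d; lra.
(* For large h the crude bounds suffice: the cut is at most 2 Q, the penalty at most h / 84, and
   (1/4 - 1/84) (42/5) = 2. *)
case: (leP (42 / 5 * Q) h) => hbig.
  have : 0 <= 1 / 21 * Lam * Q * d ^+ 2
    by rewrite mulr_ge0 ?sqr_ge0// mulr_ge0 ?(ltW Q0)//; lra.
  have : q * a * y0 ^+ 2 <= q * a * (1 / 4) by rewrite ler_wpM2l.
  have : (1 - q) * b * y1 ^+ 2 <= (1 - q) * b * (1 / 4) by rewrite ler_wpM2l.
  have : Q * (1 + d - (q - 1 / 2 + (q * y0 + (1 - q) * y1)) ^+ 2) <= Q * 2.
    rewrite ler_wpM2l ?(ltW Q0)//.
    have := sqr_ge0 (q - 1 / 2 + (q * y0 + (1 - q) * y1)); lra.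
  have hE : h = q * a + (1 - q) * b by [].
  lra.
set y := q * y0 + (1 - q) * y1 in gz.
set x := q - 1 / 2 in hh gz.
set z := x + y in gz.
(* As y = z - x, the growth of the penalty is charged to the slack in z^2 of the cut and the slack
   in x^2 of the entropy. *)
have yz : y ^+ 2 <= 2 * z ^+ 2 + 2 * x ^+ 2.
  rewrite -subr_ge0 (_ : _ - _ = (z + x) ^+ 2) ?sqr_ge0//.
  by rewrite /z; ring.
have young (p : R) : -1 <= p <= 1 ->
    (y + p * d) ^+ 2 <= 21 / 20 * y ^+ 2 + 21 * d ^+ 2.
  move=> /andP[p0 p1]; have := sqr_ge0 (y - 20 * (p * d)).
  have : p ^+ 2 * d ^+ 2 <= d ^+ 2 by rewrite ler_piMl ?sqr_ge0//; nra.
  nra.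
have Y0 : y0 ^+ 2 <= 21 / 20 * y ^+ 2 + 21 * d ^+ 2.
  by rewrite (_ : y0 = y + (1 - q) * d); [apply: young; lra|rewrite /y /d; ring].
have Y1 : y1 ^+ 2 <= 21 / 20 * y ^+ 2 + 21 * d ^+ 2.
  by rewrite (_ : y1 = y + - q * d); [apply: young; lra|rewrite /y /d; ring].
(* After division by 21, the z^2 part is at most (21/25) Q z^2, within the slack Q z^2; the x^2 part
   is the term in [hx]; the d^2 part is at most (42/5) Q d^2, within the 180/21 set aside in
   [quad]. *)
have loss : q * a * y0 ^+ 2 + (1 - q) * b * y1 ^+ 2 <=
            h * (21 / 10 * z ^+ 2 + 21 / 10 * x ^+ 2 + 21 * d ^+ 2).
  rewrite [leRHS]mulrDl; apply: lerD; apply: ler_wpM2l => //; lra.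
have hz : h * z ^+ 2 <= 42 / 5 * Q * z ^+ 2 by rewrite ler_wpM2r ?sqr_ge0// ltW.
have hd : h * d ^+ 2 <= 42 / 5 * Q * d ^+ 2 by rewrite ler_wpM2r ?sqr_ge0// ltW.
(* (1 + 4 x^2 / 9) (1 - 2 x^2 / 5) = 1 + (8/45) x^2 (1/4 - x^2), and x^2 <= 1/4. *)
have hx : Q + 1 / 10 * (h * x ^+ 2) <= h / 4.
  have x2 : x ^+ 2 <= 1 / 4 by rewrite /x; nra.
  have x0 := sqr_ge0 x.
  have c0 : 0 <= 1 / 4 - 1 / 10 * x ^+ 2 by lra.
  have := ler_wpM2r c0 hh.
  have := mulr_ge0 (mulr_ge0 (ltW Q0) x0) (_ : 0 <= 1 / 4 - x ^+ 2).
  move/(_ ltac:(lra)); set X := x ^+ 2; clearbody X Q h; lra.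
have hLQ : 4 * Q / Lam <= h / Lam.
  rewrite ler_wpM2r ?invr_ge0 ?(ltW Lp)//.
  have := mulr_ge0 (ltW Q0) (sqr_ge0 x); lra.
(* The bound [64 * 180 <= Lam] is what makes the square (d Lam - 32/3)^2 suffice. *)
have quad : d <= 1 / 21 * (Lam - 180) * d ^+ 2 + 16 / 3 / Lam.
  have e : Lam^-1 * Lam = 1 by rewrite mulVf ?gt_eqF.
  rewrite -(ler_pM2r Lp) [leRHS]mulrDl -[16 / 3 / Lam * Lam]mulrA e.
  have := sqr_ge0 (d * Lam - 32 / 3).
  have : 0 <= d ^+ 2 * Lam * (Lam - 64 * 180).
    by rewrite mulr_ge0 ?subr_ge0// mulr_ge0 ?sqr_ge0 ?(ltW Lp).
  have := mulr_ge0 (sqr_ge0 d) (ltW Lp).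
  clearbody d; lra.
have {quad} : Q * d <= Q * (1 / 21 * (Lam - 180) * d ^+ 2 + 16 / 3 / Lam).
  by rewrite ler_pM2l.
move: hLQ; have -> : 4 * Q / Lam = 4 * (Q / Lam) by ring.
have -> : Q * (1 / 21 * (Lam - 180) * d ^+ 2 + 16 / 3 / Lam) =
  1 / 21 * Lam * Q * d ^+ 2 - 60 / 7 * Q * d ^+ 2 + 16 / 3 * (Q / Lam).
  by field; rewrite gt_eqF.
have := mulr_ge0 (ltW Q0) (sqr_ge0 z).
have := mulr_ge0 (ltW Q0) (sqr_ge0 d).
move: gz loss hz hd hx; set lost := q * a * y0 ^+ 2 + _.
set QL := Q / Lam; set hL' := h / Lam.
clearbody h Q d x z QL hL' lost; clear -R.
lra.
Qed.

Lemma ln2_gt0 {R : realType} : 0 < ln 2 :> R.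
Proof. by rewrite ln_gt0// ltr1n. Qed.

Lemma log2_ge0 {R : realType} (x : R) : 1 <= x -> 0 <= log2 x.
Proof.
by move=> x1; apply: divr_ge0; [apply: ln_ge0|apply: ltW ln2_gt0].
Qed.

Section Potential.
Context {R : realType}.
Implicit Types t u w : R.

(** The shift makes the bound on [Lam] hold from t = 1 on, so the induction has no exceptional small
    cases. *)
Definition shifted_log t := log2 t + 64 * 180.

Definition potential u w := let t := u + w in
  t * (log2 t / 4 - ((w - u) / (2 * t)) ^+ 2 * shifted_log t / 21
       + 4 / 3 * ln (shifted_log t) + 140).

Lemma shifted_log_ge t : 1 <= t -> 64 * 180 <= shifted_log t.
Proof. by move=> /log2_ge0; rewrite /shifted_log; lra. Qed.

Lemma imbalance_le u w : 0 <= u -> 0 <= w -> 1 <= u + w ->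
  `|(w - u) / (2 * (u + w))| <= 1 / 2.
Proof.
move=> u0 w0 uw; rewrite ler_norml ler_pdivlMr ?ler_pdivrMr; lra.
Qed.

(** The penalty is at most (log t + 64 * 180) / 84, and 140 exceeds 64 * 180 / 84. *)
Lemma potential_ge0 u w : 0 <= u -> 0 <= w -> 1 <= u + w -> 0 <= potential u w.
Proof.
move=> u0 w0 uw; rewrite /potential; apply: mulr_ge0; first by lra.
have := imbalance_le u w u0 w0 uw; set y := (w - u) / _ => hy.
have y4 : y ^+ 2 <= 1 / 4.
  clearbody y; move: hy; rewrite ler_norml => /andP[? ?].
  have : 0 <= (1 / 2 - y) * (1 / 2 + y). by rewrite mulr_ge0//; lra.
  lra.
have L0 := shifted_log_ge _ uw.
have : 0 <= ln (shifted_log (u + w)) by apply: ln_ge0; lra.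
have l0 := log2_ge0 _ uw.
have : y ^+ 2 * shifted_log (u + w) <= 1 / 4 * shifted_log (u + w).
  by rewrite ler_wpM2r//; lra.
rewrite {2}/shifted_log; lra.
Qed.

Lemma ln_le_tangent (x y : R) : 0 < x -> 0 < y -> ln x <= ln y - (y - x) / y.
Proof.
move=> x0 y0.
have := @le_ln1Dx R (x / y - 1); rewrite subrKC.
have -> : (y - x) / y = 1 - x / y by rewrite mulrBl divff ?gt_eqF.
rewrite ln_div ?posrE// => h.
have : -1 < x / y - 1 by have := divr_gt0 x0 y0; lra.
by move=> /h; lra.
Qed.

(** The constant 4/9 is 1/3 divided by 3/4, the upper bound on ln 2. *)
Lemma log2_entropy_ge (q : R) : 0 < q < 1 ->
  4 * (q * (1 - q)) * (1 + 4 / 9 * (q - 1 / 2) ^+ 2) <=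
  q * - log2 q + (1 - q) * - log2 (1 - q).
Proof.
move=> q01; have [q0 q1] := andP q01.
have l2 := @ln2_lt34 R.
have lp := @ln2_gt0 R.
have -> : q * - log2 q + (1 - q) * - log2 (1 - q) = natural_entropy q / ln 2.
  by rewrite /natural_entropy /log2; field; rewrite gt_eqF.
rewrite ler_pdivlMr//; apply: le_trans (natural_entropy_ge q q01).
rewrite -[leLHS]mulrA ler_wpM2l//.
  by rewrite mulr_ge0// mulr_ge0//; lra.
have -> : (1 - 2 * q) ^+ 2 = 4 * (q - 1 / 2) ^+ 2 by field.
have := sqr_ge0 (q - 1 / 2); set X := _ ^+ 2; clearbody X => X0.
suff : X * (4 / 9 * ln 2) <= X * (1 / 3) by lra.
by rewrite ler_wpM2l//; lra.
Qed.

Lemma log2M (x y : R) : 0 < x -> 0 < y -> log2 (x * y) = log2 x + log2 y.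
Proof. by move=> x0 y0; rewrite /log2 lnM ?posrE// mulrDl. Qed.

Lemma log2_le0 (x : R) : x <= 1 -> log2 x <= 0.
Proof.
by move=> x1; rewrite /log2 ler_pdivrMr ?ln2_gt0// mul0r ln_le0.
Qed.

(** Division by t leads to [normalized_split]. The squared imbalances contribute their variance q (1
    - q) (y0 - y1)^2, and the tangent bound for ln turns the change of the log log term into h /
    [Lam]. *)
Lemma potential_split u0 w0 u1 w1 g :
  0 <= u0 -> 0 <= w0 -> 0 <= u1 -> 0 <= w1 -> 1 <= u0 + w0 -> 1 <= u1 + w1 ->
  g <= w0 -> g <= u1 ->
  potential u0 w0 + potential u1 w1 + g <= potential (u0 + u1) (w0 + w1).
Proof.
move=> hu0 hw0 hu1 hw1 ht0 ht1 g0 g1; rewrite /potential.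
have -> : u0 + u1 + (w0 + w1) = (u0 + w0) + (u1 + w1) by ring.
have hy0 := imbalance_le _ _ hu0 hw0 ht0.
have hy1 := imbalance_le _ _ hu1 hw1 ht1.
set y0 := (w0 - u0) / _ in hy0 *; set y1 := (w1 - u1) / _ in hy1 *.
set y := (w0 + w1 - _) / _.
set t0 := u0 + w0 in y0 hy0 ht0 y *; set t1 := u1 + w1 in y1 hy1 ht1 y *.
have p0 : 0 < t0 by lra.
have p1 : 0 < t1 by lra.
set t := t0 + t1 in y *.
have tp : 0 < t by rewrite addr_gt0.
set q := t0 / t.
have q0 : 0 < q by rewrite divr_gt0.
have q1E : 1 - q = t1 / t by rewrite /q /t; field; rewrite gt_eqF.
have q1 : 0 < 1 - q by rewrite q1E divr_gt0.
have t0E : t0 = q * t by rewrite /q divfK ?gt_eqF.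
have t1E : t1 = (1 - q) * t by rewrite q1E divfK ?gt_eqF.
have yE : y = q * y0 + (1 - q) * y1.
  rewrite q1E /q /y /y0 /y1; field; rewrite !gt_eqF//.
have w0E : w0 = t0 * (1 / 2 + y0).
  by rewrite /y0 /t0; field; rewrite gt_eqF.
have u1E : u1 = t1 * (1 / 2 - y1).
  by rewrite /y1 /t1; field; rewrite gt_eqF.
have a0 : 0 <= - log2 q by rewrite oppr_ge0 log2_le0//; lra.
have b0 : 0 <= - log2 (1 - q) by rewrite oppr_ge0 log2_le0//; lra.
have L0 : 64 * 180 <= shifted_log t by apply: shifted_log_ge; rewrite /t; lra.
have q01 : 0 < q < 1 by rewrite q0 -subr_gt0.
have := @normalized_split R q y0 y1 _ _ _ (g / t) q01 hy0 hy1 a0 b0 L0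
   (log2_entropy_ge _ q01).
have -> : q * (1 / 2 + y0) = w0 / t by rewrite [in RHS]w0E /q; ring.
have -> : (1 - q) * (1 / 2 - y1) = u1 / t.
  by rewrite [in RHS]u1E q1E; ring.
rewrite !ler_pM2r ?invr_gt0// => /(_ g0 g1).
have tan (x : R) : 0 < x -> 1 <= x * t -> ln (shifted_log (x * t)) <=
    ln (shifted_log t) - (- log2 x) / shifted_log t.
  move=> x0 x1; have := shifted_log_ge _ x1 => Lx.
  have -> : - log2 x = shifted_log t - shifted_log (x * t).
    by rewrite /shifted_log log2M//; ring.
  by apply: ln_le_tangent; lra.
rewrite ler_pdivrMr// => G.
apply: le_trans (lerD (lexx _) G) _.
have := tan _ q0; rewrite -t0E => /(_ ht0) T0.
have := tan _ q1; rewrite -t1E => /(_ ht1) T1.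
have E0 : log2 t0 = log2 q + log2 t by rewrite t0E log2M.
have E1 : log2 t1 = log2 (1 - q) + log2 t by rewrite t1E log2M.
have yy : y ^+ 2 = q * y0 ^+ 2 + (1 - q) * y1 ^+ 2 - q * (1 - q) * (y0 - y1) ^+ 2.
  by rewrite yE; ring.
rewrite yy {G}.
have := ler_wpM2l (ltW p0) T0; have := ler_wpM2l (ltW p1) T1.
set M := ln _; set M0 := ln _; set M1 := ln _.
rewrite /shifted_log E0 E1 t0E t1E.
set l := log2 t; set l0 := log2 q; set l1 := log2 (1 - q).
set r := (l + _)^-1; set A := 64 * 180; set B := 140.
clearbody M M0 M1 l l0 l1 r A B y0 y1 q t; clear -R.
lra.
Qed.

End Potential.

(** * Upper bound *)

Section UpperBound.
Context {R : realType}.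

Local Open Scope set_scope.

Lemma card_having_lacking {T : finType} (i : T) (U : {set {set T}}) :
  (#|having i U| + #|lacking i U| = #|U|)%N.
Proof.
rewrite -(cardsID [set A : {set T} | i \in A] U).
rewrite (_ : having i U = U :&: [set A : {set T} | i \in A]); last first.
  by apply/finset.setP => A; rewrite !inE.
rewrite (_ : lacking i U = U :\: [set A : {set T} | i \in A])//.
by apply/finset.setP => A; rewrite !inE andbC.
Qed.

(** Strong induction on the number of sets, splitting along a coordinate with both sides nonempty.
    Without such a coordinate there are no edges. *)
Lemma cover_pairs_le_potential {T : finType} (U W : {set {set T}}) :
  (0 < #|U| + #|W|)%N ->
  #|cover_pairs U W|%:R <= potential #|U|%:R #|W|%:R :> R.
Proof.
have [n] := ubnP (#|U| + #|W|); elim: n U W => // n IH U W /ltnSE Un UW0.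
have [/existsP[i /andP[H1 H0]]|] := boolP [exists i,
    (0 < #|having i U| + #|having i W|)%N && (0 < #|lacking i U| + #|lacking i W|)%N].
  have EU := card_having_lacking i U; have EW := card_having_lacking i W.
  have := cover_pairs_split U W i; rewrite -(ler_nat R) !natrD => /le_trans; apply.
  rewrite -EU -EW !natrD ![_%:R + #|lacking _ _|%:R]addrC.
  have /IH/(_ H1) I1 : (#|having i U| + #|having i W| < n)%N by lia.
  have /IH/(_ H0) I0 : (#|lacking i U| + #|lacking i W| < n)%N by lia.
  apply: le_trans (lerD (lerD I0 I1) (lexx _)) _.
  apply: potential_split => //; rewrite -?natrD ?ler1n ?ler_nat ?geq_minl ?geq_minr//.
rewrite negb_exists => /forallP H.
rewrite cover_pairs_eq0 ?cards0 => [|i].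
  by rewrite potential_ge0// -natrD ler1n.
have := H i; rewrite negb_and -!eqn0Ngt !addn_eq0 !cards_eq0.
move=> /orP[]/andP[/eqP A0 /eqP B0]; [left|right]; apply/finset.setP => A;
  have /finset.setP/(_ A) := A0; have /finset.setP/(_ A) := B0; rewrite !inE;
  by case: (A \in U); case: (A \in W).
Qed.

Lemma L_le (t : nat) : (0 < t)%N ->
  (L t)%:R <= t%:R * (log2 t%:R / 4 + 4 / 3 * ln (shifted_log t%:R) + 140) :> R.
Proof.
move=> t0; have [G [GV /layered_cover_pairs[n [U [W [UW GE]]]] <-]] := L_attained t0.
have UWt : (#|U| + #|W| = t)%N by rewrite UW.
have := @cover_pairs_le_potential _ U W; rewrite UWt => /(_ t0) GP.
move: GE; rewrite -(ler_nat R) => /le_trans /(_ GP) /le_trans; apply.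
rewrite /potential -natrD UWt ler_wpM2l//.
have : 0 <= shifted_log t%:R :> R.
  by apply: le_trans (shifted_log_ge _ _); rewrite ?ler1n//; lra.
move=> /(mulr_ge0 (sqr_ge0 ((#|W|%:R - #|U|%:R) / (2 * t%:R)))).
lra.
Qed.

Lemma loglog_le (X : R) : \forall t \near \oo, X <= ln (log2 (t%:R : R)).
Proof.
near=> t.
have l2 := @ln2_gt0 R.
have h : expR (ln 2 * expR X) <= t%:R by near: t; exact: nbhs_infty_ger.
have tp : 0 < (t%:R : R) by apply: lt_le_trans h; exact: expR_gt0.
have h2 : expR X <= log2 (t%:R : R).
  by rewrite /log2 ler_pdivlMr// mulrC -ler_expR lnK ?posrE.
by rewrite -ler_expR lnK// posrE; apply: lt_le_trans h2; exact: expR_gt0.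
Unshelve. all: by end_near. Qed.

(** The margin [k] = 1 / ln 2 - 4/3 times ln (log t) eventually absorbs every constant, so
    coefficient 1 suffices. *)
Lemma L_upper : \forall t \near \oo, (L t)%:R <=
  1 / 4 * t%:R * log2 (t%:R : R) + t%:R * log2 (log2 (t%:R : R)).
Proof.
near=> t.
have l2 := @ln2_gt0 R; have l2' := @ln2_lt34 R.
have t0 : (0 < t)%N by near: t; exact: nbhs_infty_gt.
apply: le_trans (L_le _ t0) _.
have hA : ln (64 * 180) <= ln (log2 (t%:R : R)) by near: t; exact: loglog_le.
pose k : R := (ln 2)^-1 - 4 / 3.
have k0 : 0 < k.
  by rewrite subr_gt0 -[ltLHS]invrK ltf_pV2 ?posrE; lra.
have hB : (4 / 3 * ln 2 + 140) / k <= ln (log2 (t%:R : R)).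
  by near: t; exact: loglog_le.
set l := log2 (t%:R : R) in hA hB *.
have A1 : 1 <= (64 * 180 : R) by lra.
have lp : 0 < l.
  (* [ln] is 0 at nonpositive arguments, which contradicts [hA]. *)
  rewrite ltNge; apply/negP => /ln0 l0; move: hA; rewrite l0.
  by rewrite leNgt ln_gt0//; lra.
have Al : 64 * 180 <= l by move: hA; rewrite ler_ln ?posrE//; lra.
have : ln (shifted_log t%:R) <= ln 2 + ln l.
  rewrite -lnM ?posrE// ler_ln ?posrE /shifted_log -/l; lra.
move: hB; rewrite ler_pdivrMr// => hB hS.
have -> : 1 / 4 * t%:R * l + t%:R * log2 l = t%:R * (l / 4 + log2 l) by ring.
rewrite ler_wpM2l//.
have -> : log2 l = ln l * k + 4 / 3 * ln l by rewrite /k /log2; ring.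
lra.
Unshelve. all: by end_near. Qed.

End UpperBound.

(** * Lower bound *)

Section Realizable.
Local Open Scope nat_scope.
Local Open Scope set_scope.

Definition layer_pair {T : finType} (k : nat) (U W : {set {set T}}) : Prop :=
  [/\ 0 < k, {in U, forall A : {set T}, #|A| = k} &
             {in W, forall A : {set T}, #|A| = k.-1}].

(** The ground type is arbitrary so that disjoint unions can live on sum types. *)
Definition realizable (t e : nat) : Prop :=
  exists (T : finType) (k : nat) (U W : {set {set T}}),
    [/\ layer_pair k U W, #|U| + #|W| = t & e <= #|cover_pairs U W|].

Definition translate {T T' : finType} (f : T -> T') (X : {set T'}) (A : {set T}) :
  {set T'} := f @: A :|: X.

Lemma mem_translate {T T' : finType} (f : T -> T') (X : {set T'}) (A : {set T}) x :
  injective f -> (forall x, f x \notin X) -> (f x \in translate f X A) = (x \in A).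
Proof. by move=> fI fX; rewrite inE (negPf (fX x)) orbF mem_imset. Qed.

Lemma translate_inj {T T' : finType} (f : T -> T') (X : {set T'}) :
  injective f -> (forall x, f x \notin X) -> injective (translate f X).
Proof.
move=> fI fX A B AB; apply/finset.setP => x.
by rewrite -(mem_translate f X A x fI fX) AB mem_translate.
Qed.

Lemma card_translate {T T' : finType} (f : T -> T') (X : {set T'}) (A : {set T}) :
  injective f -> (forall x, f x \notin X) -> #|translate f X A| = #|A| + #|X|.
Proof.
move=> fI fX; rewrite cardsU card_imset// (_ : _ :&: X = finset.set0) ?cards0 ?subn0//.
apply/finset.setP => y; rewrite !inE; apply/negP => /andP[/imsetP[x _ ->]].
by rewrite (negPf (fX x)).
Qed.

Lemma cover_pairs_translate {T T' : finType} (f : T -> T') (X : {set T'})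
    (U W : {set {set T}}) : injective f -> (forall x, f x \notin X) ->
  #|cover_pairs U W| <= #|cover_pairs (translate f X @: U) (translate f X @: W)|.
Proof.
move=> fI fX; pose g (p : T * {set T}) := (f p.1, translate f X p.2).
have gI : injective g by move=> [i A] [j B] [/fI -> /(translate_inj _ _ fI fX) ->].
rewrite -(card_imset (mem (cover_pairs U W)) gI); apply/subset_leq_card/fintype.subsetP.
move=> _ /imsetP[[i A] + ->]; rewrite !inE /= => /and3P[AW iA AU].
rewrite (imset_f (translate f X) AW) negb_or fX mem_imset// iA /=.
apply/imsetP; exists (i |: A) => //.
by rewrite /translate imsetU1 finset.setUA.
Qed.

Lemma cover_pairsU {T : finType} (U1 U2 W1 W2 : {set {set T}}) :
  W1 :&: W2 = finset.set0 ->
  #|cover_pairs U1 W1| + #|cover_pairs U2 W2| <=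
  #|cover_pairs (U1 :|: U2) (W1 :|: W2)|.
Proof.
move=> W12; rewrite -cardsUI (_ : _ :&: _ = finset.set0); last first.
  apply/finset.setP => -[i A]; rewrite !inE /=; apply/negP.
  move=> /andP[/and3P[A1 _ _] /and3P[A2 _ _]].
  by have /finset.setP/(_ A) := W12; rewrite !inE A1 A2.
rewrite cards0 addn0; apply/subset_leq_card/fintype.subsetP => -[i A].
by rewrite !inE /= => /orP[]/and3P[-> -> ->]; rewrite ?orbT.
Qed.

Lemma realizable0 (t : nat) : realizable t 0.
Proof.
exists 'I_t, 1, [set [set i] | i : 'I_t], finset.set0; split => //.
- split=> // A; last by rewrite inE.
  by move=> /imsetP[i _ ->]; rewrite cards1.
- by rewrite cards0 addn0 card_imset ?card_ord//; apply: finset.set1_inj.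
Qed.

(* Padding each family by a private set makes the layers agree and keeps the
   two families disjoint. *)
Lemma realizableD (s t d e : nat) :
  realizable s d -> realizable t e -> realizable (s + t) (d + e).
Proof.
move=> [T1 [k1 [U1 [W1 [[k1p U1k W1k] s1 d1]]]]].
move=> [T2 [k2 [U2 [W2 [[k2p U2k W2k] s2 d2]]]]].
pose T : finType := ((T1 + T2) + ('I_k2 + 'I_k1))%type.
pose f1 (x : T1) : T := inl (inl x).
pose f2 (x : T2) : T := inl (inr x).
pose X1 : {set T} := [set inr (inl i) | i : 'I_k2].
(* The padding sizes are swapped, so both upper layers become k1 + k2. *)
pose X2 : {set T} := [set inr (inr i) | i : 'I_k1].
have f1I : injective f1 by move=> x y [].
have f2I : injective f2 by move=> x y [].
have fX1 x : f1 x \notin X1 by apply/imsetP => -[].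
have fX2 x : f2 x \notin X2 by apply/imsetP => -[].
have cX1 : #|X1| = k2 by rewrite card_imset ?card_ord// => x y [].
have cX2 : #|X2| = k1 by rewrite card_imset ?card_ord// => x y [].
pose g1 := translate f1 X1; pose g2 := translate f2 X2.
have g1I : injective g1 := translate_inj _ _ f1I fX1.
have g2I : injective g2 := translate_inj _ _ f2I fX2.
have disj (V1 : {set {set T1}}) (V2 : {set {set T2}}) :
    (g1 @: V1) :&: (g2 @: V2) = finset.set0.
  apply/finset.setP => A; rewrite !inE; apply/negP => /andP[/imsetP[A1 _ ->] /imsetP[A2 _]].
  (* As k2 > 0, [X1] has an element; it lies in every translate by [g1] and in none by [g2]. *)
  move/finset.setP/(_ (inr (inl (Ordinal k2p)))); rewrite /g1 /g2 /translate !inE.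
  rewrite [X in _ || X](imset_f (fun i : 'I_k2 => inr (inl i)))// orbT.
  by case/esym/orP => /imsetP[].
exists T, (k1 + k2), (g1 @: U1 :|: g2 @: U2), (g1 @: W1 :|: g2 @: W2); split.
- split; first by rewrite addn_gt0 k1p.
  + move=> A; rewrite inE => /orP[]/imsetP[B BU ->]; rewrite card_translate//.
      by rewrite U1k// cX1.
    by rewrite U2k// cX2 addnC.
  + move=> A; rewrite inE => /orP[]/imsetP[B BU ->]; rewrite card_translate//.
      by rewrite W1k// cX1 -[in RHS](prednK k1p).
    by rewrite W2k// cX2 addnC -[in RHS](prednK k2p) addnS.
- by rewrite !cardsU !disj !cards0 !card_imset// !subn0 addnACA s1 s2.
- apply: leq_trans (cover_pairsU _ _ _ _ (disj _ _)); apply: leq_add.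
    by apply: (leq_trans d1); exact: cover_pairs_translate.
  by apply: (leq_trans d2); exact: cover_pairs_translate.
Qed.

Lemma realizableM (a t e : nat) : realizable t e -> realizable (a * t) (a * e).
Proof.
by move=> te; elim: a => [|a IH]; [exact: realizable0|rewrite !mulSn; exact: realizableD].
Qed.

(** The layers k and k - 1 of the cube of dimension 2k - 1 have together 'C(2k, k) sets, and each
    lower set has k upper neighbours. *)
Lemma realizable_middle (k : nat) : 0 < k ->
  realizable 'C(k.*2, k) (k * 'C(k.*2.-1, k.-1)).
Proof.
move=> k0; pose n := k.*2.-1.
exists 'I_n, k, [set A : {set 'I_n} | #|A| == k], [set A : {set 'I_n} | #|A| == k.-1].
split.
- by split=> // A; rewrite inE => /eqP.
- rewrite !card_draws card_ord; have -> : k.*2 = n.+1 by rewrite /n; lia.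
  by rewrite -[in RHS](prednK k0) binS prednK// addnC.
- rewrite -[X in 'C(X, _)](card_ord n) -card_draws mulnC -sum_nat_const.
  rewrite -sum1_card (partition_big snd (mem [set A : {set 'I_n} | #|A| == k.-1]));
    last by move=> p; rewrite inE => /andP[].
  apply: leq_sum => A; rewrite inE => /eqP Ak.
  apply: (@leq_trans #|~: A|).
    by have := cardsC A; rewrite Ak card_ord /n; clear -k0; lia.
  have pI : injective (fun i : 'I_n => (i, A)) by move=> i j [].
  rewrite -(card_imset (mem (~: A)) pI) sum1dep_card.
  apply/subset_leq_card/fintype.subsetP => _ /imsetP[i iA ->].
  rewrite !inE /= Ak !eqxx andbT /=; move: iA; rewrite inE => iA.
  by rewrite iA cardsU1 iA Ak add1n prednK// eqxx.
Qed.

Lemma central_bin_double (k : nat) : 0 < k -> 'C(k.*2, k) = 2 * 'C(k.*2.-1, k.-1).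
Proof.
case: k => // k _; rewrite doubleS binS !succnK mulSn mul1n; congr (_ + _).
by rewrite -[LHS]bin_sub; [congr 'C(_, _)|]; lia.
Qed.

Lemma realizable_leq_L (t e : nat) : realizable t e -> e <= L t.
Proof.
move=> [T [k [U' [W' [[k0 U'k W'k] UWt ee]]]]].
pose f : T -> 'I_#|T| := enum_rank.
have fI : injective f := enum_rank_inj.
have fX x : f x \notin (finset.set0 : {set 'I_#|T|}) by rewrite inE.
pose g := translate f finset.set0.
have gI : injective g by apply: translate_inj.
pose n := #|T|; pose U := g @: U'; pose W := g @: W'.
have Uk : {in U, forall A : {set 'I_n}, #|A| = k}.
  by move=> _ /imsetP[A AU ->]; rewrite card_translate// cards0 addn0 U'k.
have Wk : {in W, forall A : {set 'I_n}, #|A| = k.-1}.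
  by move=> _ /imsetP[A AU ->]; rewrite card_translate// cards0 addn0 W'k.
have {}UWt : #|U| + #|W| = t by rewrite !card_imset.
have {}ee : e <= #|cover_pairs U W|.
  by apply: (leq_trans ee); exact: cover_pairs_translate.
(* An edge supplies an upper set of size k, whence k <= n. *)
case: (leqP e 0) => [|e0]; first by rewrite leqn0 => /eqP->.
have kn : k <= n.
  have /card_gt0P[[i A]] := leq_trans e0 ee.
  rewrite inE /= => /and3P[_ _ /Uk <-]; rewrite -[leqRHS](card_ord n).
  exact: max_card.
pose G := Defs.induced (edge_layer n k) (U :|: W).
have UWL : U :|: W \subset vertex_layer n k :|: vertex_layer n k.-1.
  by apply/fintype.subsetP => A; rewrite !inE => /orP[/Uk|/Wk] ->; rewrite eqxx ?orbT.
have GV : vertices G = U :|: W.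
  apply/finset.setIidPr/fintype.subsetP => A /(fintype.subsetP UWL).
  by rewrite /vertices /= !inE.
have disj : U :&: W = finset.set0.
  apply/finset.setP => A; rewrite !inE; apply/negP => /andP[/Uk Ak /Wk]; lia.
have Gt : #|vertices G| = t by rewrite GV cardsU disj cards0 subn0.
have Gl : layered G.
  exists n, k, G; split; first by rewrite k0.
    rewrite /subgraph /vertices /edges /= finset.subsetIl /=.
    by apply/fintype.subsetP => A; rewrite inE => /andP[].
  exists id; split; [by move=> ? ? _ _|by rewrite imset_id|].
  by rewrite -[RHS]imset_id; apply: eq_imset => A; rewrite imset_id.
apply: leq_trans (leq_L Gt Gl); apply: leq_trans ee _.
pose h (p : 'I_n * {set 'I_n}) := [set p.2; p.1 |: p.2].
(* The sizes k - 1 and k tell the lower end from the upper one, so an edge determines its pair. *)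
rewrite -(@card_in_imset _ _ h (mem (cover_pairs U W))); last first.
  move=> [i A] [j B]; rewrite !inE /= => /and3P[AW iA AU] /and3P[BW jB BU] hAB.
  have AB : A = B.
    have : A \in h (j, B) by rewrite -hAB !inE eqxx.
    by rewrite !inE /= => /orP[/eqP//|/eqP AE]; have := Wk _ AW; have := Uk _ BU;
       rewrite -AE; lia.
  subst B; congr (_, _).
  have : i |: A \in h (j, A) by rewrite -hAB !inE eqxx orbT.
  rewrite !inE /= => /orP[/eqP E|/eqP E].
    by move: iA; rewrite -E !inE eqxx.
  by have := setU11 i A; rewrite E !inE (negPf iA) orbF => /eqP.
apply/subset_leq_card/fintype.subsetP => _ /imsetP[[i A] + ->].
rewrite !inE /= => /and3P[AW iA AU].
have sub : h (i, A) \subset U :|: W.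
  by apply/fintype.subsetP => B; rewrite !inE /= => /orP[]/eqP->; rewrite ?AW ?AU ?orbT.
rewrite sub (fintype.subset_trans sub UWL) !andbT.
apply/existsP; exists A; apply/existsP; exists (i |: A); rewrite eqxx /=.
rewrite /symdiff (_ : A :\: (i |: A) = finset.set0) ?finset.set0U; last first.
  by apply/eqP; rewrite finset.setD_eq0 finset.subsetUr.
apply/cards1P; exists i; apply/finset.setP => j; rewrite !inE.
by case: eqVneq => [->|] //=; rewrite ?iA// ?andNb.
Qed.

(** * Central binomial coefficients and the greedy expansion *)

Lemma leq_central_bin (k : nat) : 2 * 'C(k.*2, k) <= 'C(k.+1.*2, k.+1).
Proof.
by rewrite [leqRHS]central_bin_double// doubleS !succnK leq_mul2l leq_bin2l.
Qed.

Lemma central_bin_ge (k : nat) : 2 ^ k <= 'C(k.*2, k).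
Proof.
elim: k => [|k IH]; first by rewrite bin0.
by apply: leq_trans (leq_central_bin k); rewrite expnS leq_mul2l.
Qed.

(** The square of 'C(2k, k) <= 4^k / sqrt (2k + 1); the square root yields the log log term. The
    induction step is 4 (2k + 1) (2k + 3) <= 16 (k + 1)^2. *)
Lemma central_bin_le (k : nat) : 'C(k.*2, k) ^ 2 * k.*2.+1 <= 16 ^ k.
Proof.
elim: k => [|k IH]; first by rewrite bin0.
have E : k.+1 * 'C(k.+1.*2, k.+1) = 2 * (k.*2.+1 * 'C(k.*2, k)).
  rewrite central_bin_double// doubleS succnK mulnCA; congr (2 * _).
  have -> : 'C(k.*2.+1, k) = 'C(k.*2.+1, k.+1).
    by rewrite -[RHS]bin_sub; [congr 'C(_, _)|]; lia.
  by rewrite -mul_bin_diag.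
rewrite -(leq_pmul2l (_ : 0 < k.+1 ^ 2)) ?expn_gt0// mulnA -expnMn E.
apply: (@leq_trans (4 * (k.*2.+1 * k.+1.*2.+1) * ('C(k.*2, k) ^ 2 * k.*2.+1))).
  by rewrite leq_eqVlt; apply/orP; left; apply/eqP; ring.
apply: leq_trans (leq_mul (leqnn _) IH) _.
rewrite [16 ^ k.+1]expnS [leqRHS]mulnA leq_mul2r; apply/orP; right; nia.
Qed.

(* Greedy expansion of [t] in central binomials: a remainder [s < 'C(2k+2, k+1)]
   loses at most [s] when it is served by layers of degree [k] only. *)
Lemma realizable_slope (k t : nat) :
  exists2 e, realizable t e & k * t <= 2 * e + 2 * 'C(k.*2, k).
Proof.
elim: k t => [|k IH] t; first by exists 0; [exact: realizable0|].
set M := 'C(k.+1.*2, k.+1).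
have M0 : 0 < M by rewrite bin_gt0; lia.
have [e re ke] := IH (t %% M).
exists (t %/ M * (k.+1 * 'C(k.+1.*2.-1, k)) + e).
  rewrite {1}(divn_eq t M); apply: realizableD re; apply: realizableM.
  exact: realizable_middle.
have sM := ltn_pmod t M0.
(* Doubling keeps the total error s + 2 Z below 2 M. *)
have Mk : 2 * 'C(k.*2, k) <= M := leq_central_bin k.
have ME : M = 2 * 'C(k.+1.*2.-1, k) := central_bin_double k.+1 isT.
rewrite {1}(divn_eq t M) mulnDr.
have -> : k.+1 * (t %/ M * M) = 2 * (t %/ M * (k.+1 * 'C(k.+1.*2.-1, k))).
  by rewrite {2}ME; ring.
rewrite mulnDr -!addnA leq_add2l mulSn.
set s := t %% M in sM ke *; set Z := 'C(k.*2, k) in Mk ke.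
clearbody M s Z; lia.
Qed.

(** The least m with t < 'C(2m, m) works: the slope m - 1 loses at most 2 t, and passing to m costs
    one more t. *)
Lemma L_slope (t : nat) : 0 < t ->
  exists2 m, t < 'C(m.*2, m) & m * t <= 2 * L t + 3 * t.
Proof.
move=> t0; have ex : exists m, t < 'C(m.*2, m).
  by exists t; apply: leq_trans (central_bin_ge t); apply: ltn_expl.
case: (ex_minnP ex) => -[|m] tm mmin; first by move: tm; rewrite bin0; lia.
exists m.+1 => //.
have Mt : 'C(m.*2, m) <= t by rewrite leqNgt; apply/negP => /mmin; lia.
have [e /realizable_leq_L eL me] := realizable_slope m t.
by rewrite mulSn; lia.
Qed.

End Realizable.

Lemma L_lower {R : realType} (t : nat) : (1 < t)%N ->
  1 / 4 * t%:R * log2 t%:R + 1 / 8 * t%:R * log2 (log2 t%:R) - 3 / 2 * t%:R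
    <= (L t)%:R :> R.
Proof.
move=> t1; have tp : 0 < (t%:R : R) by rewrite ltr0n; lia.
have l2 := @ln2_gt0 R.
have [m tm mL] := L_slope t (ltnW t1).
have lt0 : 0 < log2 (t%:R : R) by rewrite divr_gt0// ln_gt0// ltr1n.
have : (t ^ 2 * m.*2.+1 <= 16 ^ m)%N.
  by apply: leq_trans (central_bin_le m); rewrite leq_mul2r leq_exp2r// ltnW.
rewrite -(ler_nat R) natrM !natrX => bound.
have logX (x : R) k : 0 < x -> log2 (x ^+ k) = log2 x *+ k.
  by move=> x0; rewrite /log2 lnXn// mulrnAl.
have logle (x y : R) : 0 < x -> x <= y -> log2 x <= log2 y.
  move=> x0 xy; rewrite ler_wpM2r ?invr_ge0 ?(ltW l2)// ler_ln ?posrE//.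
  exact: lt_le_trans xy.
have log22 : log2 (2 : R) = 1 by rewrite /log2 divff ?gt_eqF.
have m0 : 0 < (m.*2.+1%:R : R) by rewrite ltr0n.
have log16 : log2 (16 ^+ m : R) = 4 * m%:R.
  rewrite logX// (_ : 16 = 2 ^+ 4); last by rewrite -natrX.
  by rewrite logX// log22 -!mulrnA -natrM.
have tsq : 0 < (t%:R ^+ 2 : R) by rewrite exprn_gt0.
have B1 : 2 * log2 (t%:R : R) + log2 (m.*2.+1%:R) <= 4 * m%:R.
  rewrite -log16; apply: le_trans (logle _ _ _ bound); last exact: mulr_gt0.
  by rewrite log2M// logX// mulr_natl.
have lm0 : 0 <= log2 (m.*2.+1%:R : R) by apply: log2_ge0; rewrite ler1n.
(* [B1] first gives 2 m >= log t, which is fed back into the term log (2m + 1) of [B1]. *)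
have B2 : log2 (log2 (t%:R : R)) <= log2 (m.*2.+1%:R).
  apply: logle => //; have -> : m.*2.+1%:R = 2 * m%:R + 1 :> R.
    by rewrite -natr1 -mul2n natrM.
  lra.
have : m%:R * t%:R <= 2 * (L t)%:R + 3 * t%:R :> R.
  by rewrite -!natrM -natrD ler_nat.
have B : log2 (t%:R : R) / 4 + log2 (log2 (t%:R : R)) / 8 <= m%:R / 2 by lra.
have := ler_wpM2l (ltW tp) B.
lra.
Qed.

Theorem theorem1p1 (R : realType) :
  (exists C : R, \forall t \near \oo,
     1 / 4 * t%:R * log2 (t%:R : R)
       + 1 / 8 * t%:R * log2 (log2 (t%:R : R)) - C * t%:R <= (L t)%:R) /\
  (exists eps : nat -> R, eps @ \oo --> (0 : R) /\
     \forall t \near \oo,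
       (L t)%:R <= 1 / 4 * t%:R * log2 (t%:R : R)
                   + (1 + eps t) * t%:R * log2 (log2 (t%:R : R))).
Proof.
split.
  exists (3 / 2); near=> t; apply: L_lower.
  by near: t; exact: nbhs_infty_gt.
(* [L_upper] already has log log coefficient 1, so the error is zero. *)
exists (fun=> 0); split; first exact: cvg_cst.
by apply: filterS (@L_upper R) => t Lt; rewrite addr0 [1 * t%:R]mul1r.
Unshelve. all: by end_near. Qed.
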